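(* Let $A=(a_{ij})$ be a real $n\times n$ matrix with nonnegative entries, let $\mathbf 1=(1,\ldots,1)^{\mathrm T}\in\mathbb R^n$, and let $L=\operatorname{diag}(A\mathbf 1)-A$. Consider the system $\dot x(t)=-L\,x(t)$, $x(t)\in\mathbb R^n$. Let $\mathcal T(L)$ be the set of initial vectors $x(0)\in\mathbb R^n$ for which $\lim_{t\to\infty}x(t)$ is a vector all of whose components are equal. Then $\mathcal T(L)=\mathcal R(L)\oplus\operatorname{span}(\mathbf 1)$, where $\mathcal R(L)$ is the range (column space) of $L$.
   Context: $\mathcal T(L)$ is called the consensus domain of the algorithm $\dot x=-Lx$. The matrix $L$ is the Laplacian matrix of the algorithm; it has zero row sums. *)

(* Defs.v *)
From HB Require Import structures.
From mathcomp Require Import all_boot all_order all_algebra.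
From mathcomp Require Import all_classical all_reals all_analysis.
Set Implicit Arguments. Unset Strict Implicit. Unset Printing Implicit Defensive.
Import Order.TTheory GRing.Theory Num.Theory.
Import numFieldNormedType.Exports.
Local Open Scope ring_scope.
Local Open Scope classical_set_scope.

Definition ones (R : realType) (n : nat) : 'cV[R]_n := const_mx 1.

Definition laplacian (R : realType) (n : nat) (A : 'M[R]_n) : 'M[R]_n :=
  diag_mx (A *m ones R n)^T - A.

Definition is_solution (R : realType) (n : nat) (L : 'M[R]_n)
    (x : R -> 'cV[R]_n) (x0 : 'cV[R]_n) : Prop :=
  x 0 = x0 /\ forall t : R, is_derive t 1 x (- (L *m x t)).

Definition consensus_domain (R : realType) (n : nat) (L : 'M[R]_n)
    : set 'cV[R]_n :=
  [set x0 | exists x : R -> 'cV[R]_n, is_solution L x x0 /\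
            exists c : R, x t @[t --> +oo] --> c *: ones R n].

Definition range_mx (R : realType) (n : nat) (L : 'M[R]_n) : set 'cV[R]_n :=
  [set v | exists y : 'cV[R]_n, v = L *m y].

Definition span_ones (R : realType) (n : nat) : set 'cV[R]_n :=
  [set v | exists c : R, v = c *: ones R n].

(* Main.v *)
Require Import Defs.
From HB Require Import structures.
From mathcomp Require Import all_boot all_order all_algebra.
From mathcomp Require Import all_classical all_reals all_analysis.
From mathcomp Require Import ring.
Import Order.TTheory GRing.Theory Num.Theory.
Import numFieldNormedType.Exports.
Local Open Scope ring_scope.
Local Open Scope classical_set_scope.

(* Writing [L = d (I - P)] with [P] row-stochastic, the solution starting at [x]
   is [x(t) = E (P ^ N x)] with [N] a Poisson variable of mean [d t]. For
   [x = c 1 + L y] this is [c 1 + d E (P ^ N y - P ^ (N + 1) y)], and since [P] is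
   a sup-norm contraction and [E (g (N + 1)) = E ((N / s) g N)] for [N] of mean
   [s], the last expectation is at most [|y| E |N / s - 1| <= |y| / sqrt s] by the
   variance of [N]. Conversely, [w x(t)] is constant whenever [w L = 0], so
   [x(t) --> c 1] forces [x(0) - c 1] into the range of [L]. *)

(** * Expectations under the Poisson distribution, as power series *)

Section PoissonMean.
Context {R : realType}.
Implicit Types (f g : R^nat) (s l : R).

(** Partial sums of [E (f N)] for [N] Poisson of mean [s]; the factor [expR (- s)] stays outside so
    that results on power series apply to the rest. *)
Definition poisson_sum f s : R^nat :=
  fun n => expR (- s) * pseries (fun k => f k * (k`!%:R)^-1) s n.

Definition poisson_mean f s : R := limn (poisson_sum f s).

Lemma poisson_sumE f s n :
  poisson_sum f s n =
  \sum_(0 <= k < n) f k * (expR (- s) * exp_coeff s k).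
Proof.
rewrite /poisson_sum /pseries /series /= mulr_sumr; apply: eq_bigr => k _.
by rewrite /exp_coeff /=; ring.
Qed.

(** Domination by [G] times the exponential series at [|s|]. *)
Lemma cvg_pseries_bounded f (G s : R) : (forall k, `|f k| <= G) ->
  cvgn (pseries (fun k => f k * (k`!%:R)^-1) s).
Proof.
move=> fG; apply: normed_cvg; apply: (@series_le_cvg _ _ (G *: exp_coeff `|s|)).
- by move=> k; exact: normr_ge0.
- move=> k; apply: mulr_ge0; last exact: exp_coeff_ge0.
  exact: le_trans (fG 0%N).
- move=> k /=; rewrite !normrM normrX -mulrA.
  apply: ler_pM => //.
  by rewrite /exp_coeff /= mulrC normfV normr_nat.
- exact/is_cvg_seriesZ/is_cvg_series_exp_coeff.
Qed.

Lemma cvg_poisson_bounded f (G s : R) : (forall k, `|f k| <= G) ->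
  poisson_sum f s @ \oo --> poisson_mean f s.
Proof.
move=> fG; apply: is_cvgM; first exact: is_cvg_cst.
exact: cvg_pseries_bounded fG.
Qed.

Lemma poisson_meanE f (G s : R) : (forall k, `|f k| <= G) ->
  poisson_mean f s =
  expR (- s) * limn (pseries (fun k => f k * (k`!%:R)^-1) s).
Proof.
move=> fG; apply: cvg_lim => //; apply: cvgM; first exact: cvg_cst.
exact: cvg_pseries_bounded fG.
Qed.

Lemma poisson_sum_lin f g s (a b l1 l2 : R) :
  poisson_sum f s @ \oo --> l1 -> poisson_sum g s @ \oo --> l2 ->
  poisson_sum (fun k => a * f k + b * g k) s @ \oo --> a * l1 + b * l2.
Proof.
move=> fl gl; have -> : poisson_sum (fun k => a * f k + b * g k) s =
    (fun n => a * poisson_sum f s n + b * poisson_sum g s n).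
  apply/funext => n; rewrite !poisson_sumE !mulr_sumr -big_split.
  by apply: eq_bigr => k _ /=; ring.
by apply: cvgD; apply: cvgM => //; exact: cvg_cst.
Qed.

Lemma poisson_sum_bigsum m (a : 'I_m -> R) (f : 'I_m -> R^nat) s
    (l : 'I_m -> R) :
  (forall j, poisson_sum (f j) s @ \oo --> l j) ->
  poisson_sum (fun k => \sum_j a j * f j k) s @ \oo --> \sum_j a j * l j.
Proof.
move=> fl; have -> : poisson_sum (fun k => \sum_j a j * f j k) s =
    (fun n => \sum_j a j * poisson_sum (f j) s n).
  apply/funext => n; rewrite poisson_sumE.
  under [RHS]eq_bigr do rewrite poisson_sumE mulr_sumr.
  rewrite exchange_big; apply: eq_bigr => k _.
  by rewrite mulr_suml; apply: eq_bigr => j _; rewrite -mulrA.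
  apply: cvg_big => [|j _]; first exact: add_continuous.
  by apply: cvgM => //; exact: cvg_cst.
Qed.

Lemma pseries_diffs_fact f :
  pseries_diffs (fun k => f k * (k`!%:R)^-1) =
  (fun k => f k.+1 * (k`!%:R)^-1).
Proof.
apply/funext => k; rewrite /pseries_diffs mulrCA factS natrM invfM mulVKf //.
Qed.

(** Since [k / k! = 1 / (k - 1)!], weighting by [k] amounts to differentiating the power series of
    [f] and multiplying by [s], while the derivative has the shifted coefficients [f k.+1]. *)
Lemma poisson_sum_size_biased f s l :
  poisson_sum (fun k => f k.+1) s @ \oo --> l ->
  poisson_sum (fun k => k%:R * f k) s @ \oo --> s * l.
Proof.
move=> fl.
have cv : pseries (fun k => f k.+1 * (k`!%:R)^-1) s @ \oo --> expR s * l.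
  have -> : pseries (fun k => f k.+1 * (k`!%:R)^-1) s =
      (fun n => expR s * poisson_sum (fun k => f k.+1) s n).
    by apply/funext => n; rewrite /poisson_sum mulrA expRxMexpNx_1 mul1r.
  by apply: cvgM => //; exact: cvg_cst.
have := cv; rewrite -pseries_diffs_fact => cv'.
have /pseries_diffs_equiv :
    cvgn (pseries (pseries_diffs (fun k => f k * (k`!%:R)^-1)) s).
  by apply/cvg_ex; exists (expR s * l).
rewrite (cvg_lim _ cv') // => /(cvgM (cvg_cst (expR (- s) * s))).
rewrite (_ : expR (- s) * s * (expR s * l) = s * l); last first.
  by rewrite -[RHS]mul1r -(expRxMexpNx_1 s); ring.
apply: cvg_trans; apply: near_eq_cvg; near=> n.
(* The term of index 0 vanishes on both sides; in the others the factor [s] restores the power lost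
   by differentiation. *)
rewrite poisson_sumE /series /= mulr_sumr; apply: eq_bigr => -[|k] _.
  by rewrite !mul0r mulr0.
by rewrite /exp_coeff /= exprS; ring.
Unshelve. all: by end_near. Qed.

Lemma poisson_sum_le f g s l1 l2 : 0 <= s -> (forall k, `|f k| <= g k) ->
  poisson_sum f s @ \oo --> l1 -> poisson_sum g s @ \oo --> l2 -> `|l1| <= l2.
Proof.
move=> s0 fg fl gl.
apply: (ler_cvg_to (cvg_norm fl) gl); near=> n.
rewrite !poisson_sumE; apply: le_trans (ler_norm_sum _ _ _) _.
apply: ler_sum => k _; have p0 : 0 <= expR (- s) * exp_coeff s k.
  by rewrite mulr_ge0 ?expR_ge0 ?exp_coeff_ge0.
by rewrite normrM (ger0_norm p0) ler_wpM2r.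
Unshelve. all: by end_near. Qed.

Lemma poisson_sum1 s : poisson_sum (fun=> 1) s @ \oo --> (1 : R).
Proof.
rewrite -[X in _ --> X](expRxMexpNx_1 s) mulrC.
apply: cvgM; first exact: cvg_cst.
have -> : (fun k => 1 * (k`!%:R)^-1) = (fun k => (k`!%:R)^-1) :> R^nat.
  by apply/funext => k; rewrite mul1r.
rewrite /pseries -exp_coeffE; exact: is_cvg_series_exp_coeff.
Qed.

Lemma poisson_variance s :
  poisson_sum (fun k => (k%:R - s) ^+ 2) s @ \oo --> s.
Proof.
have h0 := poisson_sum1 s.
have h1 : poisson_sum (fun k => k%:R * 1) s @ \oo --> s * 1.
  exact: poisson_sum_size_biased.
(* Size-biasing with [f k = k] gives [E (N ^ 2) = s E (N + 1)]. *)
have h2 : poisson_sum (fun k => k%:R * k%:R) s @ \oo --> s * (s + 1).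
  apply: (@poisson_sum_size_biased (fun k => k%:R)).
  have := poisson_sum_lin _ _ _ 1 1 _ _ h1 h0.
  have -> : (fun k => 1 * (k%:R * 1) + 1 * 1) = (fun k => k.+1%:R) :> R^nat.
    by apply/funext => k; rewrite -natr1; ring.
  by rewrite mul1r !mulr1.
have h3 := poisson_sum_lin _ _ _ 1 (- s *+ 2) _ _ h2 h1.
have := poisson_sum_lin _ _ _ 1 (s ^+ 2) _ _ h3 h0.
have -> : 1 * (1 * (s * (s + 1)) + - s *+ 2 * (s * 1)) + s ^+ 2 * 1 = s by ring.
set F := (X in poisson_sum X).
by have -> : F = (fun k => (k%:R - s) ^+ 2) by apply/funext => k; rewrite /F; ring.
Qed.

(** By size-biasing, [s] times the difference is the mean of [(N - s) g N]. A pointwise AM-GM bound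
    takes the place of Cauchy-Schwarz, so only the variance enters. *)
Lemma poisson_mean_shift_le g (G s : R) : 0 < s -> (forall k, `|g k| <= G) ->
  `|poisson_mean (fun k => g k.+1) s - poisson_mean g s| <= G / Num.sqrt s.
Proof.
move=> s0 gG.
have h1 := cvg_poisson_bounded g G s gG.
have h2 := cvg_poisson_bounded (fun k => g k.+1) G s (fun k => gG _).
have h3 := poisson_sum_lin _ _ _ 1 (- s) _ _ (poisson_sum_size_biased _ _ _ h2) h1.
set a := Num.sqrt s; have a0 : 0 < a by rewrite sqrtr_gt0.
have sa : s = a ^+ 2 by rewrite sqr_sqrtr // ltW.
(* The majorant of [G |N - s|]: with these weights each half has mean [G a / 2], because the
   variance is [s = a ^ 2]. *)
have h4 := poisson_sum_lin _ _ _ (G * a / 2) (G / a / 2) _ _ (poisson_sum1 s)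
  (poisson_variance s).
have G0 : 0 <= G by exact: le_trans (gG 0%N).
have := poisson_sum_le _ _ _ _ _ (ltW s0) _ h3 h4.
set m1 := poisson_mean _ _; set m2 := poisson_mean _ _ => H.
have {}H : `|s * (m1 - m2)| <= G * a.
  rewrite mulrBr -mulNr -(mul1r (s * m1)).
  have -> : G * a = G * a / 2 * 1 + G / a / 2 * s.
    by rewrite sa; field; rewrite gt_eqF.
  apply: H => k.
  have -> : 1 * (k%:R * g k) + - s * g k = (k%:R - s) * g k by ring.
  rewrite normrM mulrC; apply: le_trans (ler_wpM2r (normr_ge0 _) (gG k)) _.
  rewrite -[_ ^+ 2]real_normK ?num_real //; set u := `|_|.
  (* AM-GM: [u <= (a + u ^ 2 / a) / 2] *)
  have -> : G * a / 2 * 1 + G / a / 2 * u ^+ 2 =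
     G * u + G * ((u - a) ^+ 2 / a / 2) by field; rewrite gt_eqF.
  by rewrite lerDl mulr_ge0 // !divr_ge0 ?sqr_ge0 // ltW.
move: H; rewrite normrM (gtr0_norm s0) sa ler_pdivlMr // => H.
rewrite -(ler_pM2r a0); apply: le_trans H; rewrite le_eqVlt; apply/orP; left.
by apply/eqP; ring.
Qed.

(** Product rule: differentiating the power series shifts [f], and differentiating [expR (- s)]
    gives the subtracted term. *)
Lemma is_derive_poisson_mean f (G s : R) : (forall k, `|f k| <= G) ->
  is_derive s 1 (poisson_mean f)
    (poisson_mean (fun k => f k.+1) s - poisson_mean f s).
Proof.
move=> fG; have fG' k : `|f k.+1| <= G by [].
rewrite (poisson_meanE _ _ _ fG') (poisson_meanE _ _ s fG).
rewrite (_ : poisson_mean f = (expR \o -%R) *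
    (fun x => limn (pseries (fun k => f k * (k`!%:R)^-1) x))); last first.
  by apply/funext => x; rewrite (poisson_meanE _ _ _ fG).
have : is_derive s 1 (fun x => limn (pseries (fun k => f k * (k`!%:R)^-1) x))
    (limn (pseries (fun k => f k.+1 * (k`!%:R)^-1) s)).
  have -> : pseries (fun k => f k.+1 * (k`!%:R)^-1) s =
     pseries (pseries_diffs (fun k => f k * (k`!%:R)^-1)) s.
    by rewrite pseries_diffs_fact.
  (* Termwise differentiation at [s] needs the series and its first two formal derivatives to
     converge at a point of larger modulus. *)
  apply: (@pseries_snd_diffs _ _ (`|s| + 1)).
  - exact: cvg_pseries_bounded fG.
  - by rewrite pseries_diffs_fact; exact: cvg_pseries_bounded fG'.
  - rewrite !pseries_diffs_fact.
    by apply: (cvg_pseries_bounded (fun k => f k.+2) G) => k.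
  - by rewrite [ltRHS]ger0_norm ?addr_ge0 // ltrDl.
move=> df; apply: trigger_derive => /=.
by rewrite /GRing.scale /=; ring.
Qed.

Lemma poisson_mean0 f : poisson_mean f 0 = f 0%N.
Proof.
apply: cvg_lim => //; apply: (@cvg_near_cst _ _ _ _ \oo) => //.
(* The sum is empty at [n = 0], so the sequence is constant only from [n = 1] on. *)
near=> n; have n0 : (0 < n)%N by near: n; exact: nbhs_infty_gt.
rewrite poisson_sumE big_ltn // big_nat big1 => [|k /andP[k0 _]].
  by rewrite /exp_coeff /= oppr0 expR0 expr0 fact0 divr1 !mulr1 addr0.
by rewrite /exp_coeff /= expr0n gtn_eqF // mul0r !mulr0.
Unshelve. all: by end_near. Qed.

End PoissonMean.

(** * Entrywise limits and derivatives of matrix-valued functions *)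

Section MatrixLimits.
Context {R : realType} {m n : nat}.

Lemma cvg_mxP {T : Type} (F : set_system T) {FF : Filter F}
    (X : T -> 'M[R]_(m, n)) (M : 'M[R]_(m, n)) :
  X @ F --> M <-> forall i j, X t i j @[t --> F] --> M i j.
Proof.
split=> [XM i j|XM]; first exact: cvg_comp XM (@coord_continuous R m n i j M).
apply/cvgrPdist_le => e e0; near=> t.
rewrite /Num.Def.normr /= mx_normrE (bigmax_le _ (ltW e0)) //= => i _.
(* There are finitely many entries, so the entrywise bounds eventually hold together. *)
rewrite !mxE; move: i; near: t; apply: filter_forall => -[i j].
by move/cvgrPdist_le: (XM i j) => /(_ e e0).
Unshelve. all: by end_near. Qed.

Lemma is_derive_mxP (X : R -> 'M[R]_(m, n)) (t : R) (D : 'M[R]_(m, n)) :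
  is_derive t 1 X D <-> forall i j, is_derive t 1 (fun t => X t i j) (D i j).
Proof.
split=> [XD i j|XD].
  have dX : derivable X t 1 by exact: ex_derive.
  apply: DeriveDef; first by move/derivable_mxP: dX; exact.
  by have := derive_val (is_derive := XD); rewrite derive_mx // => <-; rewrite mxE.
have dX : derivable X t 1 by apply/derivable_mxP => i j; exact: ex_derive.
apply: DeriveDef => //; rewrite derive_mx //; apply/matrixP => i j.
by rewrite mxE; exact: derive_val.
Qed.

End MatrixLimits.

(** * The flow of [- d (I - P)] for a row-stochastic [P] *)

Section StochasticFlow.
Context {R : realType} {n : nat}.
Variables (P : 'M[R]_n) (d : R).
Hypothesis P_ge0 : forall i j, 0 <= P i j.
Hypothesis P_row : forall i, \sum_j P i j = 1.
Hypothesis d_gt0 : 0 < d.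
Implicit Types (x y : 'cV[R]_n) (t : R).

Lemma iter_stochastic_bounded y : exists G, forall i k,
  `|iter k (mulmx P) y i 0| <= G.
Proof.
(* Rows of [P] take averages, so any common bound on the entries of [y] persists under iteration;
   this sum is one. *)
exists (\sum_i `|y i 0|) => i k; elim: k i => [|k IH] i.
  by rewrite (bigD1 i) //= lerDl sumr_ge0.
rewrite iterS mxE; apply: le_trans (ler_norm_sum _ _ _) _.
rewrite -[leRHS]mul1r -(P_row i) mulr_suml; apply: ler_sum => j _.
by rewrite normrM ger0_norm // ler_wpM2l.
Qed.

(** This is the matrix exponential [exp (- d t (I - P)) x], expanded in powers of [P] only. *)
Definition stochastic_flow x t : 'cV[R]_n :=
  \col_i poisson_mean (fun k => iter k (mulmx P) x i 0) (d * t).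

(** Finite sums commute with the Poisson mean. For [Q = P] this identifies the shifted mean in the
    derivative of the flow. *)
Lemma stochastic_flow_mulmx (Q : 'M[R]_n) x t i (f : R^nat) :
  (forall k, f k = (Q *m iter k (mulmx P) x) i 0) ->
  poisson_mean f (d * t) = (Q *m stochastic_flow x t) i 0.
Proof.
move=> /funext ->; have [G xG] := iter_stochastic_bounded x.
apply: cvg_lim => //; rewrite mxE.
under eq_bigr do rewrite mxE.
under [X in poisson_sum X]eq_fun do rewrite mxE.
by apply: poisson_sum_bigsum => j; exact: cvg_poisson_bounded (xG j).
Qed.

Lemma stochastic_flow_solution x :
  is_solution (d *: (1%:M - P)) (stochastic_flow x) x.
Proof.
split=> [|t].
  by apply/matrixP => i j; rewrite mxE mulr0 poisson_mean0 ord1.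
apply/is_derive_mxP => i j; rewrite {j}ord1.
have [G xG] := iter_stochastic_bounded x.
have df := @is_derive_poisson_mean _ _ _ (d * t) (xG i).
have -> : (fun t => stochastic_flow x t i 0) =
    poisson_mean (fun k => iter k (mulmx P) x i 0) \o ( *%R d).
  by apply/funext => u; rewrite mxE.
have -> (F : 'cV_n) : (- (d *: (1%:M - P) *m F)) i 0 = d * ((P *m F) i 0 - F i 0).
  rewrite -scalemxAl mulmxBl mul1mx; move: (P *m F) => PF.
  by rewrite !mxE; ring.
rewrite [stochastic_flow x t i 0]mxE.
rewrite -(@stochastic_flow_mulmx P x t i (fun k => iter k.+1 (mulmx P) x i 0)) //.
apply: is_derive_eq.
by rewrite /GRing.scale /=; ring.
Qed.

Lemma stochastic_flow_consensus (c : R) y :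
  stochastic_flow (c *: ones R n + d *: (1%:M - P) *m y) t @[t --> +oo]
    --> c *: ones R n.
Proof.
apply/cvg_mxP => i j; rewrite {j}ord1 !mxE mulr1.
have [G yG] := iter_stochastic_bounded y.
have Pones : P *m ones R n = ones R n.
  apply/matrixP => k j; rewrite !mxE -(P_row k).
  by apply: eq_bigr => l _; rewrite mxE mulr1.
set x := _ + _.
(* [P] fixes the vector of ones and commutes with [I - P]. The neutral factors [1] give the shape of
   [poisson_sum_lin]. *)
have xE k : iter k (mulmx P) x i 0 =
    c * 1 + 1 * (d * iter k (mulmx P) y i 0 + - d * iter k.+1 (mulmx P) y i 0).
  have -> : iter k (mulmx P) x = c *: ones R n +
      (d *: iter k (mulmx P) y - d *: iter k.+1 (mulmx P) y).
    elim: k => [|k IH].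
      by rewrite /= /x -scalemxAl mulmxBl mul1mx scalerBr.
    by rewrite iterS IH mulmxDr mulmxBr -!scalemxAr Pones.
  by rewrite !mxE; ring.
have flowE t : stochastic_flow x t i 0 =
    c + d * (poisson_mean (fun k => iter k (mulmx P) y i 0) (d * t)
           - poisson_mean (fun k => iter k.+1 (mulmx P) y i 0) (d * t)).
  rewrite mxE (funext xE).
  have h1 := cvg_poisson_bounded _ _ (d * t) (yG i).
  have h2 := cvg_poisson_bounded (fun k => iter k.+1 (mulmx P) y i 0) G (d * t)
    (fun k => yG i k.+1).
  have h3 := poisson_sum_lin _ _ _ c 1 _ _ (poisson_sum1 (d * t))
    (poisson_sum_lin _ _ _ d (- d) _ _ h1 h2).
  rewrite [LHS](cvg_lim _ h3) //; ring.
apply/cvgrPdist_le => e e0; near=> t.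
have t0 : 0 < t by near: t; exact: nbhs_pinfty_gt.
have dt0 : 0 < d * t by rewrite mulr_gt0.
have G0 : 0 <= G by exact: le_trans (yG i 0%N).
rewrite flowE opprD addNKr normrN normrM (gtr0_norm d_gt0) distrC.
have := poisson_mean_shift_le _ _ _ dt0 (yG i) => /(ler_wpM2l (ltW d_gt0)).
move=> /le_trans; apply.
(* The threshold is [d G / sqrt (d t) <= e] solved for [t]. *)
have : (d * G / e) ^+ 2 / d <= t by near: t; apply: nbhs_pinfty_ge; exact: num_real.
rewrite ler_pdivrMr // => H.
have sdt : d * G / e <= Num.sqrt (d * t).
  rewrite -(ger0_norm (_ : 0 <= d * G / e)); last first.
    by rewrite divr_ge0 ?mulr_ge0 // ltW.
  by rewrite -sqrtr_sqr ler_wsqrtr // [d * t]mulrC.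
rewrite mulrA ler_pdivrMr ?sqrtr_gt0 //.
by move: sdt; rewrite ler_pdivrMr // [e * _]mulrC.
Unshelve. all: by end_near. Qed.

End StochasticFlow.

(** * The Laplacian: direct sum and reduction to a stochastic matrix *)

Section Laplacian.
Context {R : realType} {n : nat}.
Variable A : 'M[R]_n.
Hypothesis A_ge0 : forall i j, 0 <= A i j.
Implicit Types x y : 'cV[R]_n.

Lemma laplacianE i j :
  laplacian A i j = (\sum_k A i k) *+ (i == j) - A i j.
Proof.
rewrite !mxE; congr (_ *+ _ - _).
by apply: eq_bigr => k _; rewrite mxE mulr1.
Qed.

Lemma laplacian_mulmxE y i :
  (laplacian A *m y) i 0 = \sum_j A i j * (y i 0 - y j 0).
Proof.
rewrite mxE; under eq_bigr do rewrite laplacianE mulrBl.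
rewrite big_split /= sumrN (bigD1 i) //= eqxx mulr1n.
rewrite [X in _ + X - _]big1 => [|j ji]; last by rewrite eq_sym (negbTE ji) mul0r.
rewrite addr0 mulr_suml -sumrN -big_split.
by apply: eq_bigr => j _; rewrite mulrBr.
Qed.

Lemma laplacian_ones : laplacian A *m ones R n = 0.
Proof.
apply/matrixP => i j; rewrite ord1 laplacian_mulmxE [RHS]mxE big1 // => k _.
by rewrite !mxE subrr mulr0.
Qed.

(* At a maximal (minimal) entry of [y], the entry of [L y] is nonnegative
   (nonpositive). *)
Lemma range_laplacian_cap_span_ones :
  range_mx (laplacian A) `&` @span_ones R n = [set 0].
Proof.
apply/seteqP; split=> [v [[y vy] [c vc]]|v ->] /=; last first.
  by split; [exists 0; rewrite mulmx0 | exists 0; rewrite scale0r].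
(* An extremal entry exists only for [n > 0]; for [n = 0] every vector is zero. *)
case: (pickP (fun _ : 'I_n => true)) => [i0 _|n0]; last first.
  by apply/matrixP => i; have := n0 i.
have cE i : c = \sum_j A i j * (y i 0 - y j 0).
  by rewrite -laplacian_mulmxE -vy vc !mxE mulr1.
suff c0 : c = 0 by rewrite vc c0 scale0r.
apply/eqP; rewrite eq_le; apply/andP; split.
- case: (Order.TotalTheory.arg_minP (fun i => y i 0) (isT : xpredT i0)) => i _ ymin.
  rewrite (cE i); apply: sumr_le0 => j _.
  by rewrite mulr_ge0_le0 // subr_le0 ymin.
- case: (Order.TotalTheory.arg_maxP (fun i => y i 0) (isT : xpredT i0)) => i _ ymax.
  rewrite (cE i); apply: sumr_ge0 => j _.
  by rewrite mulr_ge0 // subr_ge0; exact: ymax.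
Qed.

Lemma laplacian_stochastic : exists (P : 'M[R]_n) (d : R),
  [/\ forall i j, 0 <= P i j, forall i, \sum_j P i j = 1, 0 < d &
      laplacian A = d *: (1%:M - P)].
Proof.
(* [d] dominates every row sum, which keeps the diagonal of [I - L / d] nonnegative; the added 1
   keeps [d] positive when [A = 0]. *)
pose d := 1 + \sum_i \sum_j A i j.
have S0 i : 0 <= \sum_j A i j by exact: sumr_ge0.
have d0 : 0 < d by rewrite ltr_pwDl // sumr_ge0.
exists (1%:M - d^-1 *: laplacian A), d; split=> //.
- move=> i j.
  have -> : (1%:M - d^-1 *: laplacian A) i j =
      d^-1 * (d *+ (i == j) - laplacian A i j).
    by move: (laplacian A) => M; rewrite !mxE mulrBr mulrnAr mulVf // lt0r_neq0.
  rewrite mulr_ge0 ?invr_ge0 ?(ltW d0) // laplacianE opprB addrCA addr_ge0 //.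
  rewrite -mulrnBl mulrn_wge0 // subr_ge0 /d [X in 1 + X](bigD1 i) //= addrCA lerDl.
  by rewrite addr_ge0 // sumr_ge0.
- move=> i; pose P := 1%:M - d^-1 *: laplacian A.
  transitivity ((P *m ones R n) i 0).
    by rewrite mxE; apply: eq_bigr => j _; rewrite [ones _ _ _ _]mxE mulr1.
  by rewrite mulmxBl mul1mx -scalemxAl laplacian_ones scaler0 subr0 mxE.
- by rewrite opprB addrC subrK scalerA divff ?scale1r // gt_eqF.
Qed.

End Laplacian.

(** * Conserved functionals and the necessity of the range condition *)

Section Conservation.
Context {R : realType} {n : nat}.

Lemma left_kernel_conserved (L : 'M[R]_n) x x0 (w : 'rV[R]_n) (t : R) :
  w *m L = 0 -> is_solution L x x0 -> w *m x t = w *m x0.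
Proof.
move=> wL [x00 dx]; rewrite -x00; apply/matrixP => i j; rewrite !ord1.
apply: (@is_derive_0_is_cst _ (fun t => (w *m x t) 0 0) t 0) => {}t.
have dxj k : is_derive t 1 (fun t => x t k 0) ((- (L *m x t)) k 0).
  by have /is_derive_mxP := dx t; exact.
rewrite (_ : (fun t => _) = \sum_k (w 0 k \*: (fun t => x t k 0))); last first.
  by apply/funext => u; rewrite mxE fct_sumE.
apply: is_derive_eq.
have := congr1 (fun M => (M *m x t) 0 0) wL.
rewrite mul0mx -mulmxA mxE [RHS]mxE => wLx.
rewrite -[RHS]oppr0 -[in RHS]wLx -sumrN; apply: eq_bigr => k _.
by rewrite [(- (L *m x t)) _ _]mxE /GRing.scale /= mulrN.
Qed.

Lemma consensus_domain_sub (L : 'M[R]_n) x0 : consensus_domain L x0 ->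
  exists c, range_mx L (x0 - c *: ones R n).
Proof.
move=> [x [xsol [c xc]]]; exists c.
(* Matrix subspaces are row spaces, so the column space of [L] is handled through [L^T]. *)
suff : ((x0 - c *: ones R n)^T <= L^T)%MS.
  by case/submxP => D /(congr1 trmx); rewrite trmxK trmx_mul trmxK; exists D^T.
rewrite submxE; apply/eqP/matrixP => i k; rewrite [RHS]mxE ord1 {i}.
(* The transposed columns of the cokernel are functionals [w] with [w L = 0], and they detect
   membership in the range. *)
set K := cokermx L^T; pose w := row k K^T.
have wL : w *m L = 0.
  by rewrite -row_mul -[L]trmxK -trmx_mul mulmx_coker trmx0 row0.
have wv v : (v^T *m K) 0 k = (w *m v) 0 0.
  by rewrite !mxE; apply: eq_bigr => j _; rewrite !mxE mulrC.
rewrite wv mulmxBr mxE; apply/eqP; rewrite [X in _ + X]mxE subr_eq0; apply/eqP.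
(* Two limits of [w x(t)] are compared: it is constantly [w x0], and it tends to [w (c 1)]. *)
apply: (@cvg_unique _ _ ((fun t => (w *m x t) 0 0) @ +oo)) => //.
  have -> : (fun t => (w *m x t) 0 0) = cst ((w *m x0) 0 0).
    by apply/funext => t; rewrite (left_kernel_conserved _ _ _ _ _ wL xsol).
  exact: cvg_cst.
have -> : (fun t => (w *m x t) 0 0) = (fun t => \sum_j w 0 j * x t j 0).
  by apply/funext => t; rewrite mxE.
rewrite [(w *m _) 0 0]mxE; apply: cvg_big => [|j _]; first exact: add_continuous.
by apply: cvgM; [exact: cvg_cst | have /cvg_mxP := xc; exact].
Qed.

End Conservation.

Theorem theorem3 (R : realType) (n : nat) (A : 'M[R]_n)
    (hA : forall i j, 0 <= A i j) :
  let L := laplacian A in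
  (* T(L) = R(L) + span(1) ... *)
  consensus_domain L =
    [set v | exists y z, range_mx L y /\ @span_ones R n z /\ v = y + z]
  (* ... and the sum is direct: R(L) ∩ span(1) = {0} *)
  /\ range_mx L `&` @span_ones R n = [set 0].
Proof.
move=> L; split; last exact: range_laplacian_cap_span_ones.
apply/seteqP; split.
  move=> x0 /consensus_domain_sub[c cL].
  exists (x0 - c *: ones R n), (c *: ones R n); split=> //.
  by split; [exists c | rewrite subrK].
move=> _ [_ [_ [[y ->] [[c ->] ->]]]].
have [P [d [P0 P1 d0 LE]]] := laplacian_stochastic _ hA.
rewrite /L LE [_ + c *: _]addrC.
(* [consensus_domain] asks for some solution, so the explicit flow suffices. *)
exists (stochastic_flow P d (c *: ones R n + d *: (1%:M - P) *m y)).
split; first exact: stochastic_flow_solution.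
by exists c; exact: stochastic_flow_consensus.
Qed.
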